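(* Let $\Gamma$ be a quiver with vertices $1,\dots,n$, $\theta:\mathbb{Z}^n\to\mathbb{Z}$ a stability function and $\mu\in\mathbb{Q}$. Let $M$ be a nonzero representation of $\Gamma$ over a field $k$, let $e=(e_1,\dots,e_n)$ be a nilpotent endomorphism of $M$ with $e_i$ of type $\lambda^i$, put $\lambda_*=(\lambda^1,\dots,\lambda^n)$, and let $r$ be the largest part among $\lambda^1,\dots,\lambda^n$. Let $$M_{i-1,i-1}\subseteq M_{i,r}\subseteq M_{i,r-1}\subseteq\cdots\subseteq M_{i,i}\qquad(i=1,\dots,r),\qquad M_{0,0}=0,\quad M_{r,r}=M,$$ be an $e$-compatible filtration of $M$ by subrepresentations such that (1) for $1\le i\le r$ and $i\le s\le r-1$, $M_{i,s}/M_{i,s+1}\cong M_{1,s}/M_{1,s+1}$, with $\dim(M_{1,s}/M_{1,s+1})=\lambda_*^{(s)}$; (2) for $1\le i\le r$, $M_{i,r}/M_{i-1,i-1}\cong M_{1,r}$, with $\dim M_{1,r}=\lambda_*^{(r)}$. Put $M_{1,r+1}=0$. Then $M$ is semistable of slope $\mu$ if and only if, for all $1\le s\le r$, the quotient $M_{1,s}/M_{1,s+1}$ is either zero or semistable of slope $\mu$.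
   Context: A quiver $\Gamma$ has vertex set $\{1,\dots,n\}$ and finitely many arrows. A representation over $k$ assigns a finite-dimensional $k$-vector space $V_i$ to each vertex and a linear map $V_i\to V_j$ to each arrow $i\to j$; its dimension vector is $(\dim V_1,\dots,\dim V_n)\in\mathbb{N}^n$. An endomorphism $e=(e_i)$ is nilpotent if all $e_i$ are nilpotent. The type of a nilpotent linear map is the partition formed by its Jordan block sizes. For a partition $\lambda$, $m_\lambda^{(k)}$ is the number of parts equal to $k$, and $\lambda_*^{(k)}=(m_{\lambda^1}^{(k)},\dots,m_{\lambda^n}^{(k)})$. A filtration $0=N_0\subseteq N_1\subseteq\cdots\subseteq N_t=M$ by subrepresentations is $e$-compatible if $e(N_l)\subseteq N_{l-1}$ for $1\le l\le t$; the chain of the $M_{i,s}$ is taken in the order $M_{0,0},M_{1,r},\dots,M_{1,1},M_{2,r},\dots,M_{2,2},\dots,M_{r,r}$. The stability function $\theta:\mathbb{Z}^n\to\mathbb{Z}$ is additive. The slope of a nonzero representation $N$ with dimension vector $\alpha$ is $\theta(\alpha)/\sum_i\alpha_i$. A nonzero representation $N$ is semistable if every nonzero proper subrepresentation has slope at most the slope of $N$; ''semistable of slope $\mu$'' means semistable with slope equal to $\mu$. *)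

(* Defs.v *)
From mathcomp Require Import all_boot all_order all_algebra.

Set Implicit Arguments.
Unset Strict Implicit.
Unset Printing Implicit Defensive.

Import GRing.Theory Num.Theory.
Local Open Scope ring_scope.

Record quiver (n : nat) := Quiver {
  arrow : finType;
  src : arrow -> 'I_n;
  tgt : arrow -> 'I_n
}.

Record rep (k : fieldType) (n : nat) (Q : quiver n) := Rep {
  rsp :> 'I_n -> vectType k;
  rmap : forall a : arrow Q, 'Hom(rsp (src a), rsp (tgt a))
}.
Arguments Rep {k n Q} rsp rmap.
Arguments rmap {k n Q} M a : rename.

Section Reps.
Variables (k : fieldType) (n : nat) (Q : quiver n).
Implicit Types M N : rep k Q.

Definition zero_rep M : bool := [forall i, fullv == 0%VS :> {vspace M i}].

Definition dim_vec M : 'rV[nat]_n := \row_i \dim (fullv : {vspace M i}).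

Record rep_hom M N := RepHom {
  hmap :> forall i, 'Hom(M i, N i);
  hmapP : forall (a : arrow Q) (x : M (src a)),
    hmap (tgt a) (rmap M a x) = rmap N a (hmap (src a) x)
}.

Definition rep_iso M N : Prop :=
  exists g : rep_hom M N, forall i, bijective (g i).

Definition nilpotent_hom M (e : rep_hom M M) : Prop :=
  forall i, exists m : nat, forall x : M i, iter m (e i) x = 0.

Record subrep M := SubRep {
  sub_sp :> forall i, {vspace M i};
  sub_stable : forall a, (rmap M a @: sub_sp (src a) <= sub_sp (tgt a))%VS
}.

Definition sub_zero M (U : subrep M) : bool := [forall i, U i == 0%VS].
Definition sub_full M (U : subrep M) : bool := [forall i, U i == fullv].
Definition sub_le M (U W : subrep M) : bool := [forall i, (U i <= W i)%VS].

Definition subrep_rep M (U : subrep M) : rep k Q :=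
  @Rep k n Q (fun i => subvs_of (U i))
    (fun a => linfun (vsproj (U (tgt a))) \o rmap M a
                \o linfun (@vsval _ _ (U (src a))))%VF.

(* The model of V / W is the complement W^C of W, with canonical projection
   the projection onto W^C along W; see quo_proj_surj, quo_proj_ker and
   quo_projP below. *)
Definition quo_proj (V : vectType k) (W : {vspace V}) :
    'Hom(V, subvs_of (W^C)%VS) :=
  (linfun (vsproj (W^C)%VS) \o daddv_pi (W^C)%VS W)%VF.

Definition quo_rep M (W : subrep M) : rep k Q :=
  @Rep k n Q (fun i => subvs_of ((W i)^C)%VS)
    (fun a => quo_proj (W (tgt a)) \o rmap M a
                \o linfun (@vsval _ _ ((W (src a))^C)%VS))%VF.

Lemma capvC0 (V : vectType k) (W : {vspace V}) : (W^C :&: W)%VS = 0%VS.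
Proof. by rewrite capvC capv_compl. Qed.

Lemma subrep_repE M (U : subrep M) a (x : subrep_rep U (src a)) :
  vsval (rmap (subrep_rep U) a x) = rmap M a (vsval x).
Proof.
rewrite !comp_lfunE !lfunE /=; apply: vsprojK.
by apply: (subvP (sub_stable U a)); apply: memv_img; apply: subvsP.
Qed.

Lemma quo_proj_surj (V : vectType k) (W : {vspace V}) (y : subvs_of (W^C)%VS) :
  quo_proj W (vsval y) = y.
Proof.
rewrite comp_lfunE lfunE /= daddv_pi_id ?capvC0 ?subvsP //; exact: vsvalK.
Qed.

Lemma quo_proj_ker (V : vectType k) (W : {vspace V}) (x : V) :
  (quo_proj W x == 0) = (x \in W).
Proof.
have sumE : x \in (W^C + W)%VS by rewrite addvC addv_complf memvf.
have dec := daddv_pi_add (capvC0 W) sumE.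
have -> : (quo_proj W x == 0) = (daddv_pi (W^C)%VS W x == 0).
  rewrite -(inj_eq val_inj) comp_lfunE lfunE; congr (_ == _).
  by apply: vsprojK; exact: memv_pi.
apply/eqP/idP => [p0 | xW]; first by rewrite -dec p0 add0r memv_pi.
have eqW : daddv_pi W (W^C)%VS x = x by rewrite daddv_pi_id // capvC capvC0.
by apply: (addIr x); rewrite -{2}eqW dec add0r.
Qed.

Lemma quo_projP M (W : subrep M) a (x : M (src a)) :
  quo_proj (W (tgt a)) (rmap M a x) =
  rmap (quo_rep W) a (quo_proj (W (src a)) x).
Proof.
set y := quo_proj (W (src a)) x.
have xyW : x - vsval y \in W (src a).
  by rewrite -quo_proj_ker linearB /= quo_proj_surj subrr.
have -> : rmap (quo_rep W) a y = quo_proj (W (tgt a)) (rmap M a (vsval y)).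
  have ev : linfun (@vsval _ _ _) y = vsval y by rewrite lfunE.
  by rewrite -ev -[RHS]comp_lfunE -[RHS]comp_lfunE.
apply/eqP; rewrite -subr_eq0 -!linearB /=.
by rewrite quo_proj_ker (subvP (sub_stable W a)) ?memv_img.
Qed.

Fact sub_restr_stable M (U W : subrep M) (a : arrow Q) :
  (rmap (subrep_rep U) a
     @: (linfun (@vsval _ _ (U (src a))) @^-1: W (src a))
   <= linfun (@vsval _ _ (U (tgt a))) @^-1: W (tgt a))%VS.
Proof.
apply/subvP => _ /memv_imgP [x + ->].
rewrite -!memv_preim => xW.
have -> y : linfun (@vsval _ _ (U (tgt a))) y = vsval y by rewrite lfunE.
rewrite (subrep_repE x); apply: (subvP (sub_stable W a)); apply: memv_img.
by move: xW; rewrite lfunE.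
Qed.

(* W as a subrepresentation of U, when W is contained in U (the intersection
   of U and W in general). *)
Definition sub_restr M (U W : subrep M) : subrep (subrep_rep U) :=
  @SubRep (subrep_rep U)
    (fun i => (linfun (@vsval _ _ (U i)) @^-1: W i)%VS) (sub_restr_stable U W).

Definition subquo M (U W : subrep M) : rep k Q := quo_rep (sub_restr U W).

Variable theta : {additive 'rV[int]_n -> int}.

(* Only meaningful when M is nonzero. *)
Definition slope M : rat :=
  (theta (map_mx Posz (dim_vec M)))%:~R / (\sum_i dim_vec M ord0 i)%N%:R.

Definition semistable M : Prop :=
  ~~ zero_rep M /\
  forall U : subrep M, ~~ sub_zero U -> ~~ sub_full U ->
    slope (subrep_rep U) <= slope M.

Definition semistable_of_slope (mu : rat) M : Prop :=
  semistable M /\ slope M = mu.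

Definition compatible_filtration M (e : rep_hom M M) (N : nat -> subrep M)
    (t : nat) : Prop :=
  [/\ sub_zero (N 0%N), sub_full (N t) &
      forall l, (l < t)%N ->
        sub_le (N l) (N l.+1) /\
        forall i, (e i @: N l.+1 i <= N l i)%VS].

End Reps.

Definition is_partition (lam : seq nat) : bool :=
  sorted geq lam && (0%N \notin lam).

Definition nilp_jordan_block (k : fieldType) (m : nat) : 'M[k]_m :=
  \matrix_(i, j) (j == i.+1 :> nat)%:R.

Definition nilp_jordan_mx (k : fieldType) (lam : seq nat) :
    'M[k]_(\sum_(j < size lam) nth 0%N lam j) :=
  \mxdiag_(j < size lam) nilp_jordan_block k (nth 0%N lam j).

(* f has type lam: in a suitable basis of V, f is given (row i holding the
   coordinates of the image of the i-th basis vector) by the block diagonal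
   matrix with nilpotent Jordan blocks of sizes lam. *)
Definition jordan_type (k : fieldType) (V : vectType k) (f : 'End(V))
    (lam : seq nat) : Prop :=
  is_partition lam /\
  exists2 b : (\sum_(j < size lam) nth 0%N lam j).-tuple V,
    basis_of fullv b &
    forall i, f (tnth b i) = \sum_j nilp_jordan_mx k lam i j *: tnth b j.

Definition mult_vec (n : nat) (lam : 'I_n -> seq nat) (s : nat) : 'rV[nat]_n :=
  \row_i count_mem s (lam i).

Definition largest_part (n : nat) (lam : 'I_n -> seq nat) : nat :=
  (\max_(i < n) \max_(p <- lam i) p)%N.

(* (0,0), (1,r), ..., (1,1), (2,r), ..., (2,2), ..., (r,r) *)
Definition filt_index (r : nat) : seq (nat * nat) :=
  (0%N, 0%N) :: [seq (i, s) | i <- iota 1 r, s <- rev (iota i (r.+1 - i))].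

Example filt_index3 : filt_index 3 =
  [:: (0, 0); (1, 3); (1, 2); (1, 1); (2, 3); (2, 2); (3, 3)]%N.
Proof. by []. Qed.

(* Main.v *)
Require Import Defs.
From mathcomp Require Import all_boot all_order all_algebra.
From mathcomp Require Import zify lra.
Import Order.TTheory GRing.Theory Num.Theory.
Local Open Scope ring_scope.

(* Put deg N = theta(dim N) - mu * sum_i dim N_i, which is additive on short
   exact sequences.  Then N is zero or semistable of slope mu iff deg N = 0 and
   deg U <= 0 for every subrepresentation U.  Write P_s for M_{1,s}/M_{1,s+1}.
   If all P_s have this property, intersecting U with the filtration gives
   deg U <= 0.  Conversely let M be semistable of slope mu and suppose
   deg P_j = 0 for all j > s.  Then deg M_{1,s} = deg P_s, so deg P_s <= 0,
   while deg M_{s,s} = deg M = 0, so deg P_s = - deg M_{s-1,s-1} >= 0. *)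

Set Implicit Arguments.
Unset Strict Implicit.
Unset Printing Implicit Defensive.

(** * Dimension vectors of images, preimages and subquotients *)

Section Homs.
Variables (k : fieldType) (n : nat) (Q : quiver n).
Implicit Types M N : rep k Q.

(** Taken on families of subspaces, so that it applies to vertexwise intersections such as $U_i \cap
    A_i$ without packaging them as subrepresentations. *)
Definition sub_dim M (U : forall i, {vspace M i}) : 'rV[nat]_n :=
  \row_i \dim (U i).

Lemma dim_subrep M (U : subrep M) : dim_vec (subrep_rep U) = sub_dim U.
Proof. by apply/rowP => i; rewrite !mxE dimvf. Qed.

Fact hom_img_stable M N (f : rep_hom M N) (U : subrep M) (a : arrow Q) :
  (rmap N a @: (f (src a) @: U (src a)) <= f (tgt a) @: U (tgt a))%VS.
Proof.
apply/subvP => _ /memv_imgP [_ /memv_imgP [x xU ->] ->].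
by rewrite -hmapP memv_img // (subvP (sub_stable U a)) ?memv_img.
Qed.

Definition hom_img M N (f : rep_hom M N) (U : subrep M) : subrep N :=
  @SubRep _ _ _ N (fun i => f i @: U i)%VS (hom_img_stable f U).

Fact hom_preim_stable M N (f : rep_hom M N) (U : subrep N) (a : arrow Q) :
  (rmap M a @: (f (src a) @^-1: U (src a)) <= f (tgt a) @^-1: U (tgt a))%VS.
Proof.
apply/subvP => _ /memv_imgP [x + ->]; rewrite -!memv_preim => xU.
by rewrite hmapP (subvP (sub_stable U a)) ?memv_img.
Qed.

Definition hom_preim M N (f : rep_hom M N) (U : subrep N) : subrep M :=
  @SubRep _ _ _ M (fun i => f i @^-1: U i)%VS (hom_preim_stable f U).

Fact sub_incl_morph M (A : subrep M) (a : arrow Q) (x : subrep_rep A (src a)) :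
  linfun (@vsval _ _ (A (tgt a))) (rmap (subrep_rep A) a x) =
  rmap M a (linfun (@vsval _ _ (A (src a))) x).
Proof. by rewrite [LHS]lfunE [in RHS]lfunE; exact: subrep_repE. Qed.

Definition sub_incl M (A : subrep M) : rep_hom (subrep_rep A) M :=
  @RepHom _ _ _ (subrep_rep A) M (fun i => linfun (@vsval _ _ (A i)))
    (@sub_incl_morph M A).

Definition quo_hom M (W : subrep M) : rep_hom M (quo_rep W) :=
  @RepHom _ _ _ M (quo_rep W) (fun i => quo_proj (W i)) (@quo_projP k n Q M W).

Lemma sub_incl_inj M (A : subrep M) i : lker (sub_incl A i) = 0%VS.
Proof.
apply/eqP/lker0P => x y; rewrite !lfunE; exact: val_inj.
Qed.

Lemma limg_sub_incl M (A : subrep M) i : limg (sub_incl A i) = A i.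
Proof.
apply/vspaceP => x; apply/memv_imgP/idP => [[y _ ->] | xA].
  by rewrite lfunE subvsP.
by exists (vsproj (A i) x); rewrite ?memvf // lfunE /= vsprojK.
Qed.

Lemma lker_quo_hom M (W : subrep M) i : lker (quo_hom W i) = W i.
Proof. by apply/vspaceP => x; rewrite memv_ker quo_proj_ker. Qed.

Lemma limg_quo_hom M (W : subrep M) i : limg (quo_hom W i) = fullv.
Proof.
apply/vspaceP => y; rewrite memvf; apply/memv_imgP.
by exists (vsval y); rewrite ?memvf //= quo_proj_surj.
Qed.

Lemma dim_img_inj M N (f : rep_hom M N) (U : subrep M) :
  (forall i, lker (f i) = 0%VS) -> sub_dim (hom_img f U) = sub_dim U.
Proof.
by move=> f0; apply/rowP => i; rewrite !mxE limg_dim_eq // f0 capv0.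
Qed.

Lemma dim_sub_incl_preim M (A : subrep M) i (W : {vspace M i}) :
  \dim (sub_incl A i @^-1: W) = \dim (A i :&: W).
Proof.
rewrite -(@limg_dim_eq _ _ _ (sub_incl A i)) ?sub_incl_inj ?capv0 //.
by rewrite -lpreim_cap_limg limg_sub_incl lpreimK ?limg_sub_incl ?capvSr // capvC.
Qed.

Lemma dim_sub_restr M (A U : subrep M) :
  sub_dim (sub_restr A U) = sub_dim (fun i => A i :&: U i)%VS.
Proof. by apply/rowP => i; rewrite !mxE -dim_sub_incl_preim. Qed.

(** Rank-nullity at each vertex for the projection along $W$ restricted to $U$, whose kernel is $U_i
    \cap W_i$. *)
Lemma dim_quo_img M (W U : subrep M) :
  sub_dim U =
  sub_dim (hom_img (quo_hom W) U) + sub_dim (fun i => U i :&: W i)%VS.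
Proof.
apply/rowP => i; rewrite !mxE -[in RHS](lker_quo_hom W i) addrC.
by rewrite -(limg_ker_dim (quo_hom W i)).
Qed.

(** Rank-nullity again: the preimage maps onto $V$ because the projection is surjective, and it
    contains the whole kernel $W$. *)
Lemma dim_quo_preim M (W : subrep M) (V : subrep (quo_rep W)) :
  sub_dim (hom_preim (quo_hom W) V) = sub_dim V + sub_dim W.
Proof.
apply/rowP => i; rewrite !mxE addrC -(limg_ker_dim (quo_hom W i)).
rewrite lpreimK ?limg_quo_hom ?subvf // lker_quo_hom; congr (\dim _ + _)%N.
by apply/capv_idPr/subvP => x; rewrite -(lker_quo_hom W i) memv_ker
  -memv_preim => /eqP ->; rewrite mem0v.
Qed.

Lemma dim_quo_rep M (W : subrep M) :
  dim_vec (quo_rep W) + sub_dim W = dim_vec M.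
Proof.
apply/rowP => i; rewrite !mxE addrC -(limg_ker_dim (quo_hom W i) fullv) capfv.
by rewrite limg_quo_hom lker_quo_hom.
Qed.

Lemma dim_subquo M (A B : subrep M) :
  sub_le B A -> dim_vec (subquo A B) + sub_dim B = sub_dim A.
Proof.
move=> /forallP BA; rewrite -(dim_subrep A) -(dim_quo_rep (sub_restr A B)).
rewrite dim_sub_restr; congr (_ + _); apply/rowP => i; rewrite !mxE.
by rewrite (capv_idPr (BA i)).
Qed.

Lemma dim_rep_iso M N : rep_iso M N -> dim_vec M = dim_vec N.
Proof.
case=> f fbij; apply/rowP => i; rewrite !mxE -(limg_ker_dim (f i) fullv).
have [g fK gK] := fbij i.
have -> : lker (f i) = 0%VS by apply/eqP/lker0P; exact: can_inj fK.
rewrite capv0 dimv0 add0n; congr (\dim _); apply/vspaceP => y.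
by rewrite memvf -(gK y) memv_img ?memvf.
Qed.

Lemma rep_iso_trans M N L : rep_iso M N -> rep_iso N L -> rep_iso M L.
Proof.
move=> [f fbij] [g gbij].
have fgP (a : arrow Q) (x : M (src a)) :
    (g (tgt a) \o f (tgt a))%VF (rmap M a x) =
    rmap L a ((g (src a) \o f (src a))%VF x).
  by rewrite !comp_lfunE !hmapP.
exists (@RepHom _ _ _ M L (fun i => g i \o f i)%VF fgP) => i /=.
have fg_bij := bij_comp (gbij i) (fbij i).
by apply: (eq_bij fg_bij) => x /=; rewrite comp_lfunE.
Qed.

(** Serves to identify $M_{1,r}$ with $M_{1,r}/M_{1,r+1}$, so that the top layer $s = r$ is treated
    like the others. *)
Lemma rep_iso_subquo0 M (A B : subrep M) :
  sub_zero B -> rep_iso (subrep_rep A) (subquo A B).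
Proof.
move=> /forallP B0; exists (quo_hom (sub_restr A B)) => i.
have ker0 : lker (quo_hom (sub_restr A B) i) = 0%VS.
  rewrite lker_quo_hom /= (eqP (B0 i)) lpreim0; exact: sub_incl_inj.
pose q := quo_hom (sub_restr A B) i.
have inj : injective q by apply/lker0P/eqP.
(* The inverse sends a class to its representative in the chosen complement; it is a section of [q],
   and injectivity of [q] makes it two-sided. *)
exists (fun y => vsval y) => [x|y]; last exact: quo_proj_surj.
by apply: inj; exact: quo_proj_surj.
Qed.

Lemma zero_repE M : zero_rep M = (dim_vec M == 0).
Proof.
apply/forallP/eqP => [M0 | M0 i]; last first.
  by move/rowP/(_ i): M0; rewrite !mxE => /eqP; rewrite dimv_eq0.
by apply/rowP => i; rewrite !mxE (eqP (M0 i)) dimv0.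
Qed.

Lemma sub_zeroE M (U : subrep M) : sub_zero U = (sub_dim U == 0).
Proof.
apply/forallP/eqP => [U0 | U0 i]; last first.
  by move/rowP/(_ i): U0; rewrite !mxE => /eqP; rewrite dimv_eq0.
by apply/rowP => i; rewrite !mxE (eqP (U0 i)) dimv0.
Qed.

Lemma sub_full_dim M (U : subrep M) : sub_full U -> sub_dim U = dim_vec M.
Proof. by move=> /forallP UM; apply/rowP => i; rewrite !mxE (eqP (UM i)). Qed.

End Homs.

(** * The degree function and semistability expressed by degrees *)

Section Degree.
Variables (k : fieldType) (n : nat) (Q : quiver n).
Variables (theta : {additive 'rV[int]_n -> int}) (mu : rat).
Implicit Types M N : rep k Q.

Definition degree (d : 'rV[nat]_n) : rat :=
  (theta (map_mx Posz d))%:~R - mu * (\sum_i d ord0 i)%N%:R.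

Lemma degreeD (d1 d2 : 'rV[nat]_n) : degree (d1 + d2) = degree d1 + degree d2.
Proof.
rewrite /degree.
have -> : map_mx Posz (d1 + d2) = map_mx Posz d1 + map_mx Posz d2.
  by apply/rowP => i; rewrite !mxE.
have -> : (\sum_i (d1 + d2)%R ord0 i = \sum_i d1 ord0 i + \sum_i d2 ord0 i)%N.
  by rewrite -big_split; apply: eq_bigr => i _; rewrite mxE.
by rewrite raddfD rmorphD natrD /=; lra.
Qed.

Lemma degree0 : degree 0 = 0.
Proof. by have := degreeD 0 0; rewrite addr0; lra. Qed.

Lemma dim_total_gt0 M : ~~ zero_rep M -> (0 < \sum_i dim_vec M ord0 i)%N.
Proof.
rewrite lt0n; apply: contra; rewrite zero_repE sum_nat_eq0 => /forallP M0.
by apply/eqP/rowP => i; rewrite [RHS]mxE; apply/eqP/M0.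
Qed.

(** Clears the denominator of the slope. The total dimension is positive, so the degree has the sign
    of slope minus $\mu$. *)
Lemma degree_dim M : ~~ zero_rep M ->
  degree (dim_vec M) =
  (slope theta M - mu) * (\sum_i dim_vec M ord0 i)%N%:R.
Proof.
move=> /dim_total_gt0 M0; rewrite mulrBl divfK //.
by rewrite pnatr_eq0 -lt0n.
Qed.

Lemma degree_le0 M : ~~ zero_rep M ->
  (degree (dim_vec M) <= 0) = (slope theta M <= mu).
Proof.
move=> M0; rewrite degree_dim // pmulr_lle0 ?subr_le0 //.
by rewrite ltr0n dim_total_gt0.
Qed.

Lemma degree_eq0 M : ~~ zero_rep M ->
  (degree (dim_vec M) == 0) = (slope theta M == mu).
Proof.
move=> M0; rewrite degree_dim // mulf_eq0 subr_eq0 pnatr_eq0.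
by rewrite [X in _ || X]eqn0Ngt dim_total_gt0 // orbF.
Qed.

(** The zero representation qualifies, and $U$ may be zero or everything since both then have degree
    $0$; one predicate thus covers the alternative in the theorem. *)
Definition deg_semistable M : Prop :=
  degree (dim_vec M) = 0 /\ forall U : subrep M, degree (sub_dim U) <= 0.

Lemma deg_semistableP M :
  deg_semistable M <-> zero_rep M \/ semistable_of_slope theta mu M.
Proof.
split=> [[M0 Mle] | [M0 | [[M0 Mss] Mmu]]].
- have [zM | nzM] := boolP (zero_rep M); [by left | right].
  have sM : slope theta M = mu by apply/eqP; rewrite -degree_eq0 // M0.
  split=> //; split=> // U U0 _; rewrite sM -degree_le0 ?dim_subrep //.
  by rewrite zero_repE dim_subrep -sub_zeroE.
- split=> [|U]; first by rewrite zero_repE in M0; rewrite (eqP M0) degree0.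
  suff : sub_zero U by rewrite sub_zeroE => /eqP ->; rewrite degree0.
  apply/forallP => i; rewrite -subv0; apply: subv_trans (subvf _) _.
  by rewrite subv0; exact: (forallP M0).
- have dM : degree (dim_vec M) = 0 by apply/eqP; rewrite degree_eq0 // Mmu.
  split=> // U.
  have [|U0] := boolP (sub_zero U).
    by rewrite sub_zeroE => /eqP ->; rewrite degree0.
  have [/sub_full_dim -> | U1] := boolP (sub_full U); first by rewrite dM.
  rewrite -dim_subrep degree_le0 -?Mmu ?Mss //.
  by rewrite zero_repE dim_subrep -sub_zeroE.
Qed.

Lemma deg_semistable_iso M N :
  rep_iso M N -> deg_semistable N -> deg_semistable M.
Proof.
move=> isoMN [N0 Nle]; split=> [|U]; first by rewrite (dim_rep_iso isoMN).
case: isoMN => f fbij; rewrite -(@dim_img_inj _ _ _ _ _ f) => [|i].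
  exact: Nle.
by apply/eqP/lker0P/bij_inj.
Qed.

(** The quotient $(U \cap A)/(U \cap B)$ embeds in $A/B$ as the image of $U \cap A$, so its degree
    is at most $0$; additivity gives the inequality. *)
Lemma subquo_cap_degree M (A B U : subrep M) :
  sub_le B A -> deg_semistable (subquo A B) ->
  degree (sub_dim (fun i => U i :&: A i)%VS) <=
  degree (sub_dim (fun i => U i :&: B i)%VS).
Proof.
move=> /forallP BA [_ /(_ (hom_img (quo_hom (sub_restr A B)) (sub_restr A U)))].
have := dim_quo_img (sub_restr A B) (sub_restr A U).
rewrite dim_sub_restr.
have -> : sub_dim (fun i => A i :&: U i)%VS = sub_dim (fun i => U i :&: A i)%VS.
  by apply/rowP => i; rewrite !mxE capvC.
have -> : sub_dim (fun i => sub_restr A U i :&: sub_restr A B i)%VS =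
          sub_dim (fun i => U i :&: B i)%VS.
  apply/rowP => i; rewrite !mxE.
  have -> : (sub_restr A U i :&: sub_restr A B i)%VS =
            (sub_incl A i @^-1: (U i :&: B i))%VS.
    by apply/vspaceP => x; rewrite memv_cap -!memv_preim memv_cap.
  rewrite dim_sub_incl_preim (capv_idPr _) //.
  exact: subv_trans (capvSr _ _) (BA i).
by move=> ->; rewrite degreeD; lra.
Qed.

(** A subrepresentation $V$ of $A/B$ lifts to a subrepresentation of $M$ between $B$ and $A$, of
    degree $\deg V + \deg B = \deg V$, to which the bound for $M$ applies. *)
Lemma deg_semistable_subquo M (A B : subrep M) :
  deg_semistable M -> sub_le B A ->
  degree (sub_dim A) = 0 -> degree (sub_dim B) = 0 ->
  deg_semistable (subquo A B).
Proof.
move=> [_ Mle] BA A0 B0; split=> [|V].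
  by have := congr1 degree (dim_subquo BA); rewrite degreeD; lra.
have := Mle (hom_img (sub_incl A) (hom_preim (quo_hom (sub_restr A B)) V)).
rewrite dim_img_inj; last exact: sub_incl_inj.
rewrite dim_quo_preim degreeD dim_sub_restr.
suff -> : sub_dim (fun i => A i :&: B i)%VS = sub_dim B by rewrite B0 addr0.
by apply/rowP => i; rewrite !mxE (capv_idPr (forallP BA i)).
Qed.

End Degree.

(** * Adjacent terms of the filtration and induction along it *)

Section Filtration.
Variable r : nat.

Let row i := [seq (i, s) | s <- rev (iota i (r.+1 - i))].

(** Isolates the diagonal entry $(i,i)$, which ends row $i$ (or is the head of the list when $i =
    0$); the next row starts right after it. *)
Lemma filt_index_split i : (i <= r)%N ->
  exists p, filt_index r =
    p ++ (i, i) :: flatten [seq row j | j <- iota i.+1 (r - i)].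
Proof.
case: i => [|i] ir; first by exists [::]; rewrite subn0.
have split_r : iota 1 r = iota 1 i ++ i.+1 :: iota i.+2 (r - i.+1).
  have {1}-> : r = (i + (r - i.+1).+1)%N by lia.
  by rewrite iotaD add1n.
have row_last : row i.+1 =
    rcons [seq (i.+1, s) | s <- rev (iota i.+2 (r - i.+1))] (i.+1, i.+1).
  by rewrite /row subSS -(subnSK ir) /= rev_cons map_rcons.
exists ((0, 0)%N :: flatten [seq row j | j <- iota 1 i] ++
  [seq (i.+1, s) | s <- rev (iota i.+2 (r - i.+1))]).
rewrite /filt_index -/row split_r map_cat flatten_cat /=.
by rewrite -/(row i.+1) row_last -cats1 -!catA.
Qed.

Lemma filt_index_rows i : (1 <= i <= r)%N ->
  exists p q, filt_index r = p ++ [:: (i.-1, i.-1), (i, r) & q].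
Proof.
case: i => // i ir; have [p ->] := @filt_index_split i (ltnW ir).
exists p; rewrite -(subnSK ir) /=.
have -> : row i.+1 = (i.+1, r) :: [seq (i.+1, s) | s <- rev (iota i.+1 (r - i.+1))].
  rewrite /row subSn // -[(r - i.+1).+1]addn1 iotaD rev_cat /=.
  by rewrite subnKC.
by eexists.
Qed.

Lemma filt_index_row i s : (1 <= i <= s)%N -> (s < r)%N ->
  exists p q, filt_index r = p ++ [:: (i, s.+1), (i, s) & q].
Proof.
move=> /andP [i0 si] sr.
have ir : (i.-1 < r)%N by lia.
have [p ->] := filt_index_split (ltnW ir).
rewrite -(subnSK ir) /= prednK //.
have -> : row i = [seq (i, j) | j <- rev (iota s.+2 (r - s.+1))] ++
    [:: (i, s.+1), (i, s) & [seq (i, j) | j <- rev (iota i (s - i))]].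
  (* Row $i$ is cut into the entries below $s$, the pair $s, s+1$, and the entries above $s+1$;
     reversal then puts $s+1$ just before $s$. *)
  have er : (r.+1 - i = (s - i) + (r - s.+1).+2)%N by lia.
  by rewrite /row er iotaD subnKC //= rev_cat !rev_cons map_cat !map_rcons
    -!cats1 -!catA.
by rewrite -catA /=; eexists (_ ++ _ :: _), _; rewrite -catA.
Qed.

Variables (k : fieldType) (n : nat) (Q : quiver n) (M : rep k Q).
Variables (e : rep_hom M M) (Mf : nat -> nat -> subrep M).
Hypothesis hfilt : compatible_filtration e
  (fun l => let p := nth (0, 0)%N (filt_index r) l in Mf p.1 p.2)
  (size (filt_index r)).-1.

Lemma filt_adjacent_le a b p q : filt_index r = p ++ [:: a, b & q] ->
  sub_le (Mf a.1 a.2) (Mf b.1 b.2).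
Proof.
(* The entry [a] sits at position [size p], so the inclusion wanted is the one between positions
   [size p] and [(size p).+1]. *)
move=> def_r; case: hfilt => _ _ /(_ (size p)).
have ltSp : ((size p).+1 < size p)%N = false by lia.
rewrite def_r !nth_cat ltnn subnn ltSp subSnn size_cat /=.
by rewrite !addnS ltnS leq_addr => /(_ isT) [].
Qed.

Lemma filt_row_le i s : (1 <= i <= s)%N -> (s < r)%N ->
  sub_le (Mf i s.+1) (Mf i s).
Proof.
by move=> si sr; have [p [q /filt_adjacent_le]] := filt_index_row si sr.
Qed.

Lemma filt_rows_le i : (1 <= i <= r)%N -> sub_le (Mf i.-1 i.-1) (Mf i r).
Proof. by move=> /filt_index_rows [p [q /filt_adjacent_le]]. Qed.

Lemma filt_first : sub_zero (Mf 0 0).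
Proof. by case: hfilt. Qed.

Lemma filt_last : sub_full (Mf r r).
Proof.
have [p def_r] := filt_index_split (leqnn r); case: hfilt => _ + _.
by rewrite def_r subnn /= nth_cat size_cat addn1 ltnn subnn.
Qed.

Lemma filt_index_ind (P : nat -> nat -> Prop) :
  P 0 0 ->
  (forall i, (1 <= i <= r)%N -> P i.-1 i.-1 -> P i r) ->
  (forall i s, (1 <= i <= s)%N -> (s < r)%N -> P i s.+1 -> P i s) ->
  P r r.
Proof.
move=> P0 Prows Prow.
suff Pdiag i : (i <= r)%N -> P i i by exact: Pdiag.
elim: i => // i IH ir.
(* The second index descends from $r$ within a row, hence the induction on its distance [d] to
   $r$. *)
have Pi d : (d <= r - i.+1)%N -> P i.+1 (r - d)%N.
  elim: d => [|d IHd] dr; first by rewrite subn0; exact: (Prows i.+1 ir (IH (ltnW ir))).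
  by apply: Prow; [lia | lia | rewrite subnSK; [apply: IHd | ]; lia].
by have := Pi _ (leqnn _); rewrite subKn.
Qed.

End Filtration.

(** * Vanishing of the layer degrees: [d i s] stands for $\deg M_{i,s}$ and [c s] for $\deg P_s$ *)

Section LayerDegrees.
Variables (r : nat) (d : nat -> nat -> rat) (c : nat -> rat).
Hypothesis d_rows : forall i, (1 <= i <= r)%N -> d i r = d i.-1 i.-1 + c r.
Hypothesis d_row : forall i s, (1 <= i <= s)%N -> (s < r)%N ->
  d i s = d i s.+1 + c s.

(** Telescoping along row $i$ from $M_{i-1,i-1}$ up to $M_{i,s}$, which passes through the layers
    $r, r-1, \dots, s$. *)
Lemma layer_sum i s : (1 <= i <= s)%N -> (s <= r)%N ->
  d i s = d i.-1 i.-1 + \sum_(s <= j < r.+1) c j.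
Proof.
move=> si sr; move: {2}(r - s)%N (erefl (r - s)%N) => m.
elim: m s si sr => [|m IH] s si sr rs.
  have -> : s = r by lia.
  by rewrite big_nat1 d_rows //; lia.
rewrite d_row ?IH ?[in RHS](@big_ltn _ _ _ s); try lia.
by rewrite -addrA [c s + _]addrC.
Qed.

Hypotheses (d_first : d 0 0 = 0) (d_last : d r r = 0).
Hypothesis d_le0 : forall i s, d i s <= 0.

Lemma layer_eq0 s : (1 <= s <= r)%N -> c s = 0.
Proof.
(* Descending induction on $s$: the bound $r - s < m$ makes the vanishing of [c j] available for all
   $j > s$. *)
move: {2}(r - s).+1 (ltnSn (r - s)) => m; elim: m s => // m IH s rs sr.
have sum0 t : (s <= t)%N -> \sum_(t.+1 <= j < r.+1) c j = 0.
  by move=> st; rewrite big_nat big1 // => j tj; apply: IH; lia.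
(* Row $t+1$ with $t \ge s$ involves only layers above $s$, whose degrees vanish, so the diagonal is
   constant from $s$ to $r$. *)
have diag0 t : (s <= t <= r)%N -> d t t = d s s.
  elim: t => [|t IHt] str; first by have -> : s = 0%N by lia.
  have [-> //|st] := eqVneq s t.+1.
  by rewrite layer_sum ?sum0 ?addr0 ?IHt //; lia.
have eq1 : d 1 s = c s.
  by rewrite layer_sum ?d_first ?add0r ?(@big_ltn _ _ _ s) ?sum0 ?addr0 //; lia.
have eqs : 0 = d s.-1 s.-1 + c s.
  rewrite -[LHS]d_last diag0 1?layer_sum ?(@big_ltn _ _ _ s) ?sum0 ?addr0 //; lia.
by have := d_le0 1 s; have := d_le0 s.-1 s.-1; lra.
Qed.

(** Supplies the degree-zero conditions under which semistability passes from $M$ to the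
    subquotients of the first row. *)
Lemma first_layer_eq0 s : (1 <= s <= r)%N -> d 1 s = 0.
Proof.
move=> sr; rewrite layer_sum ?d_first ?add0r; try lia.
by rewrite big_nat big1 // => j sj; apply: layer_eq0; lia.
Qed.

End LayerDegrees.

(** * The equivalence for the filtered representation *)

Unset Implicit Arguments.

Theorem corollary2p1
  (n : nat) (Q : quiver n) (theta : {additive 'rV[int]_n -> int}) (mu : rat)
  (k : fieldType) (M : rep k Q) (hM : ~~ zero_rep M)
  (e : rep_hom M M) (he : nilpotent_hom e)
  (lam : 'I_n -> seq nat) (hlam : forall i, jordan_type (e i) (lam i))
  (r : nat) (hr : r = largest_part lam)
  (Mf : nat -> nat -> subrep M)
  (hfilt : compatible_filtration e
     (fun l => let p := nth (0, 0)%N (filt_index r) l in Mf p.1 p.2)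
     (size (filt_index r)).-1)
  (h1 : forall i s : nat, (1 <= i <= r)%N -> (i <= s <= r.-1)%N ->
     rep_iso (subquo (Mf i s) (Mf i s.+1)) (subquo (Mf 1%N s) (Mf 1%N s.+1))
     /\ dim_vec (subquo (Mf 1%N s) (Mf 1%N s.+1)) = mult_vec lam s)
  (h2 : forall i : nat, (1 <= i <= r)%N ->
     rep_iso (subquo (Mf i r) (Mf i.-1 i.-1)) (subrep_rep (Mf 1%N r))
     /\ dim_vec (subrep_rep (Mf 1%N r)) = mult_vec lam r)
  (h0 : sub_zero (Mf 1%N r.+1)) :
  semistable_of_slope theta mu M <->
  (forall s : nat, (1 <= s <= r)%N ->
     zero_rep (subquo (Mf 1%N s) (Mf 1%N s.+1)) \/
     semistable_of_slope theta mu (subquo (Mf 1%N s) (Mf 1%N s.+1))).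
Proof.
pose P s := subquo (Mf 1%N s) (Mf 1%N s.+1).
have le_last : sub_le (Mf 1%N r.+1) (Mf 1%N r).
  by apply/forallP => i; rewrite (eqP (forallP h0 i)) sub0v.
have isoP_row i s : (1 <= i <= s)%N -> (s < r)%N ->
    rep_iso (subquo (Mf i s) (Mf i s.+1)) (P s).
  by move=> si sr; case: (h1 i s) => //; lia.
(* Condition (2) compares with $M_{1,r}$ itself; $M_{1,r+1} = 0$ turns this into $P_r$. *)
have isoP_rows i : (1 <= i <= r)%N ->
    rep_iso (subquo (Mf i r) (Mf i.-1 i.-1)) (P r).
  by move=> /h2 [iso_r _]; apply: rep_iso_trans iso_r (rep_iso_subquo0 _ h0).
have -> : semistable_of_slope theta mu M <-> deg_semistable theta mu M.
  by rewrite deg_semistableP (negbTE hM); split=> [|[]] //; right.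
have -> : (forall s, (1 <= s <= r)%N ->
      zero_rep (P s) \/ semistable_of_slope theta mu (P s)) <->
    (forall s, (1 <= s <= r)%N -> deg_semistable theta mu (P s)).
  by split=> H s /H /deg_semistableP.
have first0 : sub_dim (Mf 0 0) = 0.
  by apply/eqP; rewrite -sub_zeroE (filt_first hfilt).
have last1 := sub_full_dim (filt_last hfilt).
pose dg (U : subrep M) := degree theta mu (sub_dim U).
have dg_rows i : (1 <= i <= r)%N ->
    dg (Mf i r) = dg (Mf i.-1 i.-1) + degree theta mu (dim_vec (P r)).
  move=> ir; rewrite -(dim_rep_iso (isoP_rows i ir)) addrC -degreeD.
  by rewrite dim_subquo // (filt_rows_le hfilt).
have dg_row i s : (1 <= i <= s)%N -> (s < r)%N ->
    dg (Mf i s) = dg (Mf i s.+1) + degree theta mu (dim_vec (P s)).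
  move=> si sr; rewrite -(dim_rep_iso (isoP_row i s si sr)) addrC -degreeD.
  by rewrite dim_subquo // (filt_row_le hfilt).
split=> [ssM s sr | ssP].
- have d_first : dg (Mf 0 0) = 0 by rewrite /dg first0 degree0.
  have d_last : dg (Mf r r) = 0 by rewrite /dg last1; case: ssM.
  have d_le0 i j : dg (Mf i j) <= 0 by case: ssM => _; apply.
  have d1 j := @first_layer_eq0 r _ _ dg_rows dg_row d_first d_last d_le0 j.
  have d0 : dg (Mf 1%N r.+1) = 0.
    by move: h0; rewrite sub_zeroE /dg => /eqP ->; rewrite degree0.
  (* For $s = r$ the index $(1, r+1)$ lies outside the filtration, and the convention $M_{1,r+1} =
     0$ takes over. *)
  have d1S : dg (Mf 1%N s.+1) = 0.
    by have [sr' | rs] := ltnP s r; [apply: d1 | have -> : s = r by lia].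
  apply: deg_semistable_subquo (d1 s sr) d1S => //.
  have [sr' | rs] := ltnP s r; first by rewrite (filt_row_le hfilt) //; lia.
  by have -> : s = r by lia.
(* Going up one filtration step cannot raise the degree of the intersection with $U$. *)
- have iso_ss (A B : subrep M) s : (1 <= s <= r)%N -> sub_le B A ->
      rep_iso (subquo A B) (P s) -> forall U : subrep M,
      degree theta mu (sub_dim (fun v => U v :&: A v)%VS) <=
      degree theta mu (sub_dim (fun v => U v :&: B v)%VS).
    move=> /ssP ssPs BA isoP U; apply: subquo_cap_degree => //.
    exact: deg_semistable_iso isoP ssPs.
  have degP s : (1 <= s <= r)%N -> degree theta mu (dim_vec (P s)) = 0.
    by case/ssP.
  (* This invariant is carried along the filtration; at $(r,r)$, where $M_{r,r} = M$, it is exactly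
     the degree criterion for $M$. *)
  pose Pr i s := dg (Mf i s) = 0 /\ forall U : subrep M,
    degree theta mu (sub_dim (fun v => U v :&: Mf i s v)%VS) <= 0.
  have [] : Pr r r.
    apply: (@filt_index_ind r).
    + split=> [|U]; first by rewrite /dg first0 degree0.
      suff -> : sub_dim (fun v => U v :&: Mf 0%N 0%N v)%VS = 0 by rewrite degree0.
      apply/rowP => v; rewrite !mxE.
      by rewrite (eqP (forallP (filt_first hfilt) v)) capv0 dimv0.
    + move=> i ir [d0 cap0]; split=> [|U].
        by rewrite dg_rows // d0 degP ?addr0 //; lia.
      apply: le_trans (cap0 U); apply: iso_ss (isoP_rows i ir) U; first lia.
      exact: filt_rows_le hfilt _ ir.
    + move=> i s si sr [d0 cap0]; split=> [|U].
        by rewrite dg_row // d0 degP ?addr0 //; lia.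
      apply: le_trans (cap0 U); apply: iso_ss (isoP_row i s si sr) U; first lia.
      exact: filt_row_le hfilt _ _ si sr.
  rewrite /dg last1 => degM capM; split=> // U; have := capM U.
  suff -> : sub_dim (fun v => U v :&: Mf r r v)%VS = sub_dim U by [].
  apply/rowP => v; rewrite !mxE.
  by rewrite (eqP (forallP (filt_last hfilt) v)) capvf.
Qed.
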